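(* Let $\varepsilon>0$. Then $$\lim_{K\to\infty}\mathbb{P}\left(|\tau_i-\tau_j|<\varepsilon\text{ for some }(i,j)\in\{1,\dots,K\}^2,\ i\ne j\right)=1.$$
   Context: Let $(\Omega,\mathcal F,\mathbb P,\mathbb F)$ be a filtered probability space satisfying the usual conditions, carrying an $\mathbb R^d$-valued process $X=(X_t)_{t\ge 0}$ with right-continuous paths with left limits, and a sequence of exponential random variables $Z_0,Z_1,Z_2,\dots$ of parameter $1$, independent of each other and of $X$. For $i=0,1,2,\dots$ let $\alpha_i:\mathbb R^d\to[0,\infty)$ be a non-random, positive, continuous function, and put $A_i(s)=\int_0^s\alpha_i(X_r)\,dr$; assume $\lim_{s\to\infty}A_i(s)=\infty$. Define $\eta_i=\inf\{s: A_i(s)\ge Z_i\}$ for $i\ge 0$, and the default times $\tau_i=\min(\eta_0,\eta_i)$ for $i\ge 1$. *)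

(* Defs.v *)
From HB Require Import structures.
From mathcomp Require Import all_boot all_order all_algebra finmap.
From mathcomp Require Import all_classical all_reals all_analysis.

Set Implicit Arguments.
Unset Strict Implicit.
Unset Printing Implicit Defensive.

Import Order.TTheory GRing.Theory Num.Theory.
Import numFieldNormedType.Exports.

Local Open Scope classical_set_scope.
Local Open Scope ring_scope.

(* Time is [0, +oo[: families indexed by R are only constrained, and only
   used, at indices t >= 0. *)

Definition borel (T : topologicalType) : set_system T := <<s [set U | open U] >>.

Definition is_filtration d (Omega : measurableType d) (R : realType)
    (F : R -> set_system Omega) : Prop :=
  [/\ forall t : R, 0 <= t -> sigma_algebra [set: Omega] (F t),
      forall t : R, 0 <= t -> F t `<=` measurable
    & forall s t : R, 0 <= s -> s <= t -> F s `<=` F t].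

(* The second condition also forces P to be complete on Omega, since negligible
   sets are not required to be measurable. *)
Definition usual_conditions d (Omega : measurableType d) (R : realType)
    (P : probability Omega R) (F : R -> set_system Omega) : Prop :=
  [/\ is_filtration F,
      P.-negligible `<=` F 0
    & forall t : R, 0 <= t -> F t = \bigcap_(s in [set s : R | t < s]) F s].

Definition is_process d (Omega : measurableType d) (R : realType)
    (T : topologicalType) (X : R -> Omega -> T) : Prop :=
  forall t : R, 0 <= t -> forall B, borel B -> measurable (X t @^-1` B).

Definition cadlag (R : realType) (T : topologicalType) (x : R -> T) : Prop :=
  (forall t : R, 0 <= t -> x r @[r --> t^'+] --> x t) /\
  (forall t : R, 0 < t -> exists l : T, x r @[r --> t^'-] --> l).

Definition sigma_process (Omega : Type) (R : realType)
    (T : topologicalType) (X : R -> Omega -> T) : set_system Omega :=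
  <<s \bigcup_(t in [set t : R | 0 <= t])
        preimage_set_system [set: Omega] (X t) (@borel T) >>.

Definition sigma_rv (Omega : Type) (R : realType)
    (Y : Omega -> R) : set_system Omega :=
  preimage_set_system [set: Omega] Y measurable.

Definition mutually_independent d (Omega : measurableType d) (R : realType)
    (P : probability Omega R) (I : choiceType) (G : I -> set_system Omega) :
    Prop :=
  forall (J : {fset I}) (E : I -> set Omega),
    (forall i, i \in J -> G i (E i)) ->
    P (\bigcap_(i in [set` J]) E i) = (\prod_(i <- J) P (E i))%E.

(* The variables Z 0, Z 1, ... and the whole process X are jointly independent:
   the index None stands for X and Some i for Z i. *)
Definition independent_of_each_other_and_of d (Omega : measurableType d)
    (R : realType) (P : probability Omega R) (T : topologicalType)
    (Z : nat -> Omega -> R) (X : R -> Omega -> T) : Prop :=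
  mutually_independent P (fun o : option nat =>
    if o is Some i then sigma_rv (Z i) else sigma_process X).

Section default_times.
Context d (Omega : measurableType d) (R : realType) (T : topologicalType).
Variables (X : R -> Omega -> T) (alpha : nat -> T -> R) (Z : nat -> Omega -> R).

Definition cumulated_intensity (i : nat) (s : R) (w : Omega) : \bar R :=
  (\int[lebesgue_measure]_(r in `[0%R, s]) (alpha i (X r w))%:E)%E.

(* Extended-real valued: equal to +oo when the threshold is never reached. *)
Definition eta (i : nat) (w : Omega) : \bar R :=
  ereal_inf [set s%:E | s in
    [set s : R | 0 <= s /\ ((Z i w)%:E <= cumulated_intensity i s w)%E]].

Definition tau (i : nat) (w : Omega) : \bar R := mine (eta 0 w) (eta i w).

End default_times.

(* Main.v *)
(* Independence plays no role: almost surely [A_0(s) --> +oo], so [eta_0] is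
   finite, and all the [tau_i] lie in the bounded interval [0, eta_0]; by the
   pigeonhole principle two of them are then closer than [eps].  The events are
   nondecreasing in K, so their probabilities converge to that of their union.
   The real work is their measurability: the intensities are jointly measurable
   in (w, t) because the paths are right-continuous, hence each [A_i(s)] is
   measurable by Tonelli, and hitting times of nondecreasing processes can be
   tested on rational times. *)
Require Import Defs.
From HB Require Import structures.
From mathcomp Require Import all_boot all_order all_algebra finmap.
From mathcomp Require Import all_classical all_reals all_analysis.
From mathcomp Require Import measurable_realfun lra.
Import Order.TTheory GRing.Theory Num.Theory.
Import numFieldNormedType.Exports.
Local Open Scope classical_set_scope.
Local Open Scope ring_scope.

(** * Joint measurability and hitting times *)

(** Sampling [Y] on a grid to the right of [t] gives functions that are piecewise constant in [t],
    hence jointly measurable; by right-continuity they converge to [Y] as the mesh shrinks. *)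
Lemma right_continuous_measurable_fun_prod d (Omega : measurableType d)
    (R : realType) (Y : R -> Omega -> R) :
  (forall t, measurable_fun setT (Y t)) ->
  (forall w t, Y r w @[r --> t^'+] --> Y t w) ->
  measurable_fun setT (fun x : Omega * R => Y x.2 x.1).
Proof.
move=> mY cY.
(* [g n t] is the first point of the grid of mesh 1/(n+1) strictly after t. *)
pose g (n : nat) (r : R) : R := (Num.floor (n.+1%:R * r) + 1)%:~R / n.+1%:R.
apply: (@measurable_fun_cvg _ _ _ _ (fun n x => Y (g n x.2) x.1)).
  move=> n _ B mB; rewrite setTI.
  (* On each cell [[k/(n+1), (k+1)/(n+1)[] the sampling time is constant, so the preimage is a
     countable union of measurable rectangles. *)
  rewrite [X in measurable X](_ : _ = \bigcup_(k : int)
      ((fun x : Omega * R => n.+1%:R * x.2) @^-1` `[k%:~R, (k + 1)%:~R[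
       `&` (fun x : Omega * R => Y ((k + 1)%:~R / n.+1%:R) x.1) @^-1` B));
    last first.
    apply/seteqP; split=> [x /= Bx|x [k _ [/= kx Bx]]].
      exists (Num.floor (n.+1%:R * x.2)) => //; split => //=.
      by rewrite in_itv/= floor_le floorD1_gt.
    rewrite /g (_ : Num.floor _ = k)//.
    by apply: floor_def; move: kx; rewrite in_itv.
  apply: countable_bigcupT_measurable; first exact: countableP.
  move=> k; apply: measurableI; rewrite -[X in measurable X]setTI.
    apply: (_ : measurable_fun setT (fun x : Omega * R => n.+1%:R * x.2)) => //.
    exact: measurable_funM.
  apply: (_ : measurable_fun setT
    (fun x : Omega * R => Y ((k + 1)%:~R / n.+1%:R) x.1)) => //.
  exact: measurableT_comp.
(* The sequential criterion asks for [g n t > t] strictly, whence the [+ 1] in [g]. *)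
move=> [w t] _ /=; move/cvg_at_rightP : (cY w t); apply; split.
  by move=> n; rewrite /g ltr_pdivlMr// mulrC floorD1_gt.
have gle n : t <= g n t <= t + harmonic n.
  rewrite /g /= ler_pdivlMr// ler_pdivrMr// mulrDl mulVf ?pnatr_eq0//.
  by rewrite mulrC (ltW (floorD1_gt _))/= intrD lerD2r mulrC floor_le.
apply: (@squeeze_cvgr _ _ _ _ (fun=> t) (fun n => t + harmonic n)).
- by apply: nearW => n; exact: gle.
- exact: cvg_cst.
- rewrite -[X in _ --> X]addr0.
  by apply: cvgD; [exact: cvg_cst|exact: cvg_harmonic].
Qed.

(** The infimum is below [x] iff the threshold is reached at some rational [q] in [[0, x[]: by
    monotonicity a hit at [s < x] persists at every rational of []s, x[]. *)
Lemma measurable_hitting_time d (Omega : measurableType d) (R : realType)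
    (A : R -> Omega -> \bar R) (z : Omega -> R) :
  (forall s, 0 <= s -> measurable_fun setT (A s)) ->
  (forall w s t, 0 <= s -> s <= t -> (A s w <= A t w)%E) ->
  measurable_fun setT z ->
  measurable_fun setT (fun w =>
    ereal_inf [set s%:E | s in [set s : R | 0 <= s /\ ((z w)%:E <= A s w)%E]]).
Proof.
move=> mA ndA mz.
apply: (measurability _ (ErealGenInftyO.measurableE R)) => _ [_ [x ->] <-].
pose S (q : rat) : set Omega := if 0 <= (ratr q : R) < x then
  [set w | ((z w)%:E <= A (ratr q) w)%E] else set0.
rewrite setTI [X in measurable X](_ : _ = \bigcup_q S q); last first.
  apply/seteqP; split=> [w /=|w [q _]].
    rewrite in_itv/= => /ereal_inf_ltP[_ [s [s0 zs] <-]].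
    rewrite lte_fin => sx; have [q] := rat_in_itvoo sx.
    rewrite in_itv/= => /andP[sq qx]; exists q => //.
    rewrite /S (le_trans s0 (ltW sq)) qx/=.
    exact/(le_trans zs)/ndA/ltW.
  rewrite /S; case: ifPn => // /andP[q0 qx] /= zq.
  rewrite in_itv/=; apply/ereal_inf_ltP.
  by exists (ratr q)%:E => //; exists (ratr q).
apply: bigcupT_measurable_rat => q; rewrite /S; case: ifPn => // /andP[q0 _].
rewrite -[X in measurable X]setTI; apply: measurable_lee => //; last exact: mA.
exact/measurable_EFinP.
Qed.

(** Pigeonhole: [b i] is the index of the cell of length [eps] containing [t i]. Two of the first
    [truncn (M / eps) + 2] terms share one of the [truncn (M / eps) + 1] cells, and cells are
    half-open, so the bound is strict. *)
Lemma bounded_seq_close_terms (R : archiRealFieldType) (t : nat -> R)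
    (M eps : R) :
  0 < eps -> (forall i, 0 <= t i <= M) ->
  exists i j : nat, i != j /\ `|t i - t j| < eps.
Proof.
move=> eps0 tM; pose b i := Num.truncn (t i / eps).
have b0 i : 0 <= t i / eps by case/andP: (tM i) => t0 _; rewrite divr_ge0// ltW.
have bN i : (b i < (Num.truncn (M / eps)).+1)%N.
  by rewrite ltnS le_truncn// ler_pM2r ?invr_gt0//; case/andP: (tM i).
pose f (i : 'I_(Num.truncn (M / eps)).+2) := Ordinal (bN i).
have /injectivePn[i [j ij]] : ~~ injectiveb f.
  apply/negP => /injectiveP/leq_card; rewrite !card_ord.
  by rewrite ltnn.
move=> /(congr1 val)/= bij; exists i, j; split=> //.
have /andP[] := truncn_itv (b0 i); have /andP[] := truncn_itv (b0 j).
rewrite -/(b i) -/(b j) bij !ler_pdivlMr// !ltr_pdivrMr//.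
rewrite -(natr1 (b j)) mulrDl mul1r.
by move=> *; rewrite ltr_norml; apply/andP; split; lra.
Qed.

(** * Default times and the events that two of them are close *)

(** Two infinite times do not count as close: [+oo - +oo] is [-oo], of absolute value [+oo]. *)
Definition close_defaults {d} {Omega : measurableType d} {R : realType}
    {T : topologicalType} (X : R -> Omega -> T) (alpha : nat -> T -> R)
    (Z : nat -> Omega -> R) (eps : R) (K : nat) : set Omega :=
  [set w | exists i j : nat, [/\ (1 <= i <= K)%N, (1 <= j <= K)%N, i != j
     & (`| tau X alpha Z i w - tau X alpha Z j w | < eps%:E)%E]].

Section random_times.
Context d (Omega : measurableType d) (R : realType) (T : topologicalType).
Variables (X : R -> Omega -> T) (alpha : nat -> T -> R) (Z : nat -> Omega -> R).
Hypothesis hX : is_process X.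
Hypothesis hXcadlag : forall w, cadlag (X ^~ w).
Hypothesis alpha_ge0 : forall i x, 0 <= alpha i x.
Hypothesis alpha_cont : forall i, continuous (alpha i).
Hypothesis mZ : forall i, measurable_fun setT (Z i).

(* Frozen at time 0 for t < 0, where X is not constrained. *)
Let Y i (t : R) w := alpha i (X (Num.max 0 t) w).

Let measurable_Y i t : measurable_fun setT (Y i t).
Proof.
apply: (measurability _ (RGenOInfty.measurableE R)) => _ [_ [x ->] <-].
rewrite setTI; apply: (@hX (Num.max 0 t) _ (alpha i @^-1` `]x, +oo[)).
  by rewrite le_max lexx.
apply: sub_sigma_algebra => /=.
by move: (@alpha_cont i) => /continuousP; apply; exact: rray_open.
Qed.

Let Y_right_continuous i w t : Y i r w @[r --> t^'+] --> Y i t w.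
Proof.
rewrite /Y; have [t0|t0] := leP 0 t.
  apply: (@cvg_trans _ (alpha i (X r w) @[r --> t^'+])).
    apply: near_eq_cvg; near=> r.
    by rewrite max_r// (le_trans t0)//; near: r; exact: nbhs_right_ge.
  apply: (@cvg_comp _ _ _ (X ^~ w) (alpha i) _ (nbhs (X t w))).
    by case: (hXcadlag w) => + _; exact.
  exact: alpha_cont.
apply: (@cvg_trans _ (alpha i (X 0 w) @[r --> t^'+])); last exact: cvg_cst.
apply: near_eq_cvg; near=> r; rewrite max_l//.
by near: r; exact: nbhs_right_le.
Unshelve. all: by end_near. Qed.

Let measurable_Yprod i : measurable_fun setT (fun x : Omega * R => Y i x.2 x.1).
Proof. exact: right_continuous_measurable_fun_prod. Qed.

Let cumulatedE i s w : cumulated_intensity X alpha i s w =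
  (\int[lebesgue_measure]_(r in `[0%R, s]) (Y i r w)%:E)%E.
Proof.
apply: eq_integral => r; rewrite inE/= in_itv/= => /andP[r0 _].
by rewrite /Y max_r.
Qed.

Let measurable_cumulated i s :
  measurable_fun setT (cumulated_intensity X alpha i s).
Proof.
(* Extending the integrand by zero outside [[0, s]] makes the intensity a partial integral over all
   of [R], as Tonelli requires. *)
pose f (x : Omega * R) := (\1_(`[0, s]%classic) x.2 * Y i x.2 x.1)%:E.
rewrite (_ : cumulated_intensity X alpha i s = fubini_F lebesgue_measure f).
  apply: measurable_fun_fubini_tonelli_F.
    apply/measurable_EFinP/measurable_funM; last exact: measurable_Yprod.
    have mI : measurable_fun setT (\1_(`[0, s]%classic) : R -> R).
      exact: measurable_indic.
    exact: (measurableT_comp mI measurable_snd).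
  by move=> x; rewrite lee_fin mulr_ge0// alpha_ge0.
apply/funext => w; rewrite cumulatedE integral_mkcond; apply: eq_integral => r _.
rewrite /f patchE indicE; case: ifPn => _; by rewrite ?mul1r ?mul0r.
Qed.

Let cumulated_nondecreasing i w s t : 0 <= s -> s <= t ->
  (cumulated_intensity X alpha i s w <= cumulated_intensity X alpha i t w)%E.
Proof.
move=> s0 st; rewrite !cumulatedE; apply: ge0_subset_integral => //.
- apply/measurable_EFinP/measurable_funTS.
  exact: (measurableT_comp (measurable_Yprod i) (measurable_pair1 w)).
- by move=> r _; rewrite lee_fin alpha_ge0.
- by apply: subset_itvl; rewrite bnd_simp.
Qed.

Lemma measurable_eta i : measurable_fun setT (Defs.eta X alpha Z i).
Proof.
apply: measurable_hitting_time => //.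
by move=> w s t; exact: cumulated_nondecreasing.
Qed.

Lemma measurable_tau i : measurable_fun setT (tau X alpha Z i).
Proof. by apply: measurable_mine; exact: measurable_eta. Qed.

Lemma eta_ge0 i w : (0 <= Defs.eta X alpha Z i w)%E.
Proof. by apply/ereal_infP => _ [s [s0 _] <-]; rewrite lee_fin. Qed.

Lemma tau_ge0 i w : (0 <= tau X alpha Z i w)%E.
Proof. by rewrite le_min !eta_ge0. Qed.

Lemma eta_lty i w : cumulated_intensity X alpha i s w @[s --> +oo%R] --> +oo%E ->
  (Defs.eta X alpha Z i w < +oo)%E.
Proof.
move=> /cvgey_ge/(_ (Z i w)) H.
near (+oo%R : set_system R) => s.
apply/ereal_inf_ltP; exists s%:E; last exact: ltry.
exists s => //; split; first by near: s; exact: nbhs_pinfty_ge.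
by near: s.
Unshelve. all: by end_near. Qed.

Lemma measurable_close_defaults eps K :
  measurable (close_defaults X alpha Z eps K).
Proof.
rewrite (_ : close_defaults X alpha Z eps K = \bigcup_i \bigcup_j
  if [&& (1 <= i <= K)%N, (1 <= j <= K)%N & i != j] then
  [set w | (`| tau X alpha Z i w - tau X alpha Z j w | < eps%:E)%E] else set0).
  apply: bigcupT_measurable => i; apply: bigcupT_measurable => j.
  case: ifPn => // _; rewrite -[X in measurable X]setTI.
  apply: emeasurable_fun_infty_o => //.
  apply: measurableT_comp => //.
  by apply: emeasurable_funB; exact: measurable_tau.
apply/seteqP; split => [w [i [j [iK jK ij h]]]|w [i _ [j _]]].
  by exists i => //; exists j => //; rewrite iK jK ij.
by case: ifPn => // /and3P[]; exists i, j.
Qed.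

Lemma nondecreasing_close_defaults eps :
  nondecreasing_seq (close_defaults X alpha Z eps).
Proof.
move=> m n mn; apply/subsetPset => w [i [j [/andP[i1 im] /andP[j1 jm] ij h]]].
by exists i, j; rewrite i1 j1 (leq_trans im) ?(leq_trans jm).
Qed.

Lemma eta0_lty_close_defaults eps w :
  0 < eps -> (Defs.eta X alpha Z 0 w < +oo)%E ->
  (\bigcup_K close_defaults X alpha Z eps K) w.
Proof.
move=> eps0 fin0.
have tfin i : tau X alpha Z i w \is a fin_num.
  by rewrite ge0_fin_numE ?tau_ge0// (le_lt_trans _ fin0)// ge_min lexx.
have fin0' : Defs.eta X alpha Z 0 w \is a fin_num.
  by rewrite ge0_fin_numE ?eta_ge0.
(* All default times lie in [[0, eta_0]]. The shift to [i.+1] is there because they are numbered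
   from 1. *)
have [||i [j [ij h]]] := @bounded_seq_close_terms R
    (fun i => fine (tau X alpha Z i.+1 w))
    (fine (Defs.eta X alpha Z 0 w)) eps => //.
  move=> i; rewrite fine_ge0 ?tau_ge0//= fine_le// ge_min lexx//.
exists (maxn i j).+1 => //; exists i.+1, j.+1; split => //=.
- by rewrite ltnS leq_maxl.
- by rewrite ltnS leq_maxr.
- by rewrite -(fineK (tfin i.+1)) -(fineK (tfin j.+1)) -EFinB lte_fin.
Qed.

End random_times.

(** * Passage to the limit in probability *)

Theorem theorem18 (R : realType) (disp : measure_display)
    (Omega : measurableType disp) (P : probability Omega R)
    (F : R -> set_system Omega) (d : nat) (X : R -> Omega -> 'rV[R]_d)
    (Z : nat -> {RV P >-> R}) (alpha : nat -> 'rV[R]_d -> R)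
    (hF : usual_conditions P F)
    (hX : is_process X)
    (hXcadlag : forall w, cadlag (X ^~ w))
    (hZexp : forall i B, measurable B ->
       distribution P (Z i) B = exponential_prob (1 : R) B)
    (hindep : independent_of_each_other_and_of P Z X)
    (halpha_ge0 : forall i x, 0 <= alpha i x)
    (halpha_cont : forall i, continuous (alpha i))
    (hA : forall i, {ae P, forall w,
       cumulated_intensity X alpha i s w @[s --> +oo%R] --> +oo%E})
    (eps : R) (heps : 0 < eps) :
  P [set w | exists i j : nat,
       [/\ (1 <= i <= K)%N, (1 <= j <= K)%N, i != j
         & (`| tau X alpha Z i w - tau X alpha Z j w | < eps%:E)%E]]
    @[K --> \oo] --> 1%E.
Proof.
set E := close_defaults X alpha Z eps.
have mE K : measurable (E K) by exact: measurable_close_defaults.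
have mUE : measurable (\bigcup_K E K) by exact: bigcupT_measurable.
suff <- : P (\bigcup_K E K) = 1%E.
  by apply: nondecreasing_cvg_mu => //; exact: nondecreasing_close_defaults.
(* [N] is a null set off which [A_0] diverges. The union of the events and [N] cover [Omega], so
   subadditivity gives the union full measure. *)
have [N [mN N0 hN]] := hA 0%N.
apply/eqP; rewrite eq_le probability_le1//= -[leLHS](@probability_setT _ _ _ P).
rewrite -[leRHS]adde0 -N0 (le_trans _ (measureU2 _ mUE mN))//.
apply: le_measure; rewrite ?inE//; first exact: measurableU.
move=> w _; have [Nw|Nw] := pselect (N w); [by right|left].
apply: eta0_lty_close_defaults => //.
apply: eta_lty; apply: contrapT => h; apply: Nw; exact: hN.
Qed.
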